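(* Let $d\ge 1$, let $\mathcal{D}$ be the set of $d\times d$ complex Hermitian non-negative matrices of trace one, let $\mathcal{M}$ be a finite non-empty index set, let $Y_\mu\in\mathcal{D}$ for each $\mu\in\mathcal{M}$, and let $$f:\mathcal{D}\to[-\infty,0],\qquad f(\rho)=\sum_{\mu\in\mathcal{M}}\log\left(\operatorname{Tr}(\rho Y_\mu)\right).$$ If $\overline{\rho}\in\mathcal{D}$ is an argument of the maximum of $f$ over $\mathcal{D}$, then $\overline{\rho}$ satisfies the following three conditions: (i) $\operatorname{Tr}(\overline{\rho}Y_\mu)>0$ for each $\mu\in\mathcal{M}$; (ii) $\left[\overline{\rho},\nabla f|_{\overline{\rho}}\right]=\overline{\rho}\,\nabla f|_{\overline{\rho}}-\nabla f|_{\overline{\rho}}\,\overline{\rho}=0$, where $\nabla f|_{\overline{\rho}}=\sum_{\mu\in\mathcal{M}}\frac{Y_\mu}{\operatorname{Tr}(\overline{\rho}Y_\mu)}$ is the gradient of $f$ at $\overline{\rho}$ for the Frobenius scalar product; (iii) there exists $\overline{\lambda}>0$ such that $\overline{\lambda}\,\overline{P}=\overline{P}\,\nabla f|_{\overline{\rho}}$ and $\nabla f|_{\overline{\rho}}\le\overline{\lambda}I$, where $\overline{P}$ is the orthogonal projector on the range of $\overline{\rho}$ and $I$ is the identity. When, additionally, the real vector space spanned by the $Y_\mu$, $\mu\in\mathcal{M}$, coincides with the set of all $d\times d$ Hermitian matrices, these conditions are also sufficient and characterize the unique maximum: $f$ has a unique maximizer over $\mathcal{D}$, and an element $\overline{\rho}\in\mathcal{D}$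 is this maximizer if and only if it satisfies (i), (ii) and (iii).
   Context: Convention: $\log 0=-\infty$. The Frobenius scalar product of Hermitian matrices is $\langle A,B\rangle=\operatorname{Tr}(AB)$. For Hermitian matrices, $A\le B$ means that $B-A$ is positive semidefinite. *)

(* Defs.v *)
From HB Require Import structures.
From mathcomp Require Import all_boot all_order all_algebra.
From mathcomp Require Import sesquilinear spectral.
From mathcomp Require Import boolp reals constructive_ereal ereal exp.
From mathcomp Require Import complex.

Set Implicit Arguments.
Unset Strict Implicit.
Unset Printing Implicit Defensive.

Import Order.TTheory GRing.Theory Num.Theory.
Local Open Scope ring_scope.
Local Open Scope complex_scope.
Local Open Scope sesquilinear_scope.

Section HermitianMatrices.
Variables (R : realType) (d : nat).
Implicit Types A B G H rho : 'M[R[i]]_d.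

(* In the order of R[i], 0 <= z means that z is real and non-negative. *)
Definition psdmx A : Prop :=
  A \is hermsymmx /\ forall v : 'cV[R[i]]_d, 0 <= (v^t* *m A *m v) 0 0.

Definition loewner_le A B : Prop := psdmx (B - A).

Definition density rho : Prop := psdmx rho /\ \tr rho = 1.

Definition frob_prod A B : R[i] := \tr (A *m B).

Definition frob_norm A : R := Num.sqrt (complex.Re (frob_prod A A)).

(* mxalgebra represents subspaces by row spaces: the rows of A^t* are the
   conjugate transposes of the columns of A, and the orthogonal projector being
   hermitian, it does not matter whether it acts on rows or on columns (see
   range_projP). *)
Definition range_proj A : 'M[R[i]]_d := proj_ortho (A^t*).

(* G is the (Frechet) gradient at rho, for the Frobenius scalar product, of a
   function f on the real Euclidean space of hermitian matrices. As
   -oo - -oo = -oo, the estimate forces f to be finite near rho. *)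
Definition is_frob_gradient (f : 'M[R[i]]_d -> \bar R) rho G : Prop :=
  G \is hermsymmx /\
  forall eps : R, 0 < eps -> exists2 delta : R, 0 < delta &
    forall H, H \is hermsymmx -> frob_norm H < delta ->
      (`| f (rho + H)%R - f rho - (complex.Re (frob_prod G H))%:E |
         <= (eps * frob_norm H)%:E)%E.

Definition is_maximizer (f : 'M[R[i]]_d -> \bar R) rho : Prop :=
  density rho /\ forall sigma, density sigma -> (f sigma <= f rho)%E.

End HermitianMatrices.

Section LogLikelihood.
Variables (R : realType) (d : nat) (M : finType) (Y : M -> 'M[R[i]]_d).
Implicit Type rho : 'M[R[i]]_d.

(* On hermitian arguments the trace is real, and lne x = -oo for x <= 0. *)
Definition loglik rho : \bar R :=
  (\sum_(mu : M) lne (complex.Re (\tr (rho *m Y mu)))%:E)%E.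

Definition loglik_grad rho : 'M[R[i]]_d :=
  \sum_(mu : M) (\tr (rho *m Y mu))^-1 *: Y mu.

Definition optimality_conditions rho : Prop :=
  [/\ forall mu : M, 0 < \tr (rho *m Y mu),
      rho *m loglik_grad rho - loglik_grad rho *m rho = 0
    & exists lambda : R,
        [/\ 0 < lambda,
            lambda%:C *: range_proj rho = range_proj rho *m loglik_grad rho
          & loewner_le (loglik_grad rho) (lambda%:C *: 1%:M)]].

End LogLikelihood.

Lemma hermsymmxE (R : realType) d (A : 'M[R[i]]_d) :
  (A \is hermsymmx) = (A == A^t*).
Proof. by rewrite is_hermitianmxE expr0 scale1r. Qed.

Lemma adjmxM (R : realType) m n p (A : 'M[R[i]]_(m, n)) (B : 'M[R[i]]_(n, p)) :
  (A *m B)^t* = B^t* *m A^t*.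
Proof. by rewrite trmx_mul map_mxM. Qed.

Lemma range_projP (R : realType) d (A : 'M[R[i]]_d) :
  [/\ range_proj A \is hermsymmx,
      range_proj A *m range_proj A = range_proj A
    & ((range_proj A)^T :=: A^T)%MS].
Proof.
set P := range_proj A.
have PE : (P :=: A^t*)%MS by exact: proj_orthoE.
have PP : P *m P = P by exact: proj_ortho_proj.
have Pc : (1%:M - P <= orthomx Num.conj (mx_of_hermitian (hermitian1mx _)) (A^t*))%MS.
  by rewrite -[P]mul1mx; exact: proj_ortho_compl_sub.
clearbody P.
have PH : P^t* = P.
  have h : (1%:M - P) *m P^t* = 0.
    apply/orthomx1P; rewrite orthomx_sym.
    apply: (submx_trans (_ : (P <= A^t*)%MS)); first by rewrite PE.
    by rewrite orthomx_sym.
  have {}h : P^t* = P *m P^t*.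
    by apply/eqP; rewrite -subr_eq0 -{1}[P^t*]mul1mx -mulmxBl h.
  by rewrite -[RHS]trmxCK {2}h adjmxM trmxCK -h.
split; [by rewrite hermsymmxE PH | by [] |].
have -> : P^T = map_mx Num.conj P.
  by rewrite -{2}PH -map_mx_comp map_mx_id // => x; exact: conjCK.
have -> : A^T = map_mx Num.conj (A^t*).
  by rewrite -map_mx_comp map_mx_id // => x; exact: conjCK.
apply/eqmxP/andP; split; rewrite map_submx PE //.
Qed.

Lemma psdmx_spectral (R : realType) d (A : 'M[R[i]]_d) : psdmx A ->
  exists2 U : 'M[R[i]]_d, U *m U^t* = 1%:M &
  exists2 D : 'rV[R[i]]_d, A = U^t* *m diag_mx D *m U & forall j, 0 <= D 0 j.
Proof.
move=> [hA pA].
have /orthomx_spectralP := hermitian_normalmx hA.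
have uU := spectral_unitarymx A.
move: (spectralmx A) (spectral_diag A) uU => U D uU.
rewrite invmx_unitary // => AE.
have UU : U *m U^t* = 1%:M by exact/unitarymxP.
exists U => //; exists D => // j.
have := pA ((row j U)^t*); rewrite trmxCK AE.
have rU : row j U *m U^t* = row j 1%:M by rewrite -row_mul UU.
have -> : row j U *m (U^t* *m diag_mx D *m U) *m (row j U)^t*
  = row j 1%:M *m diag_mx D *m (row j 1%:M)^t*.
  by rewrite -rU adjmxM trmxCK !mulmxA.
rewrite -row_mul mul1mx mxE (bigD1 j) //= big1 => [|k kj].
  by rewrite !mxE eqxx mulr1n rmorph1 mulr1 addr0.
by rewrite !mxE eq_sym (negbTE kj) mulr0n mul0r.
Qed.

Lemma trmx_density_itv (R : realType) d (A B : 'M[R[i]]_d) :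
  density A -> density B -> 0 <= \tr (A *m B) <= 1.
Proof.
move=> [/psdmx_spectral[U UU [D -> D0]] trA] [[_ pB] trB].
have U'U : U^t* *m U = 1%:M by exact: mulmx1C.
pose E := U *m B *m U^t*.
have E0 j : 0 <= E j j.
  have := pB ((row j U)^t*); rewrite trmxCK -row_mul.
  have -> : (row j (U *m B) *m (row j U)^t*) 0 0 = E j j; last by [].
  by rewrite /E !mxE; apply: eq_bigr => k _; rewrite !mxE.
have trE : \tr E = 1 by rewrite /E mxtrace_mulC mulmxA U'U mul1mx.
have trD : \sum_j D 0 j = 1.
  by move: trA; rewrite mxtrace_mulC mulmxA UU mul1mx mxtrace_diag.
have -> : \tr (U^t* *m diag_mx D *m U *m B) = \sum_j D 0 j * E j j.
  rewrite -!mulmxA mxtrace_mulC -!mulmxA [U *m (B *m _)]mulmxA -/E.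
  by apply: eq_bigr => j _; rewrite mul_diag_mx mxE.
apply/andP; split; first by apply: sumr_ge0 => j _; rewrite mulr_ge0.
rewrite -trD; apply: ler_sum => j _; rewrite ler_piMr // -trE /mxtrace.
by rewrite (bigD1 j) //= lerDl sumr_ge0.
Qed.

Lemma loglik_le0 (R : realType) d (M : finType) (Y : M -> 'M[R[i]]_d) rho :
  (forall mu, density (Y mu)) -> density rho -> (loglik Y rho <= 0)%E.
Proof.
move=> hY hrho; apply: sume_le0 => mu _; rewrite lne_le0 lee_fin.
have /andP[_] := trmx_density_itv hrho (hY mu).
by rewrite lecE => /andP[].
Qed.

(* Main.v *)
(* For density matrices rho and sigma write a_mu = Tr(sigma Y_mu) / Tr(rho Y_mu).
   Concavity of the logarithm shows that rho maximizes f if and only if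
   sum_mu a_mu <= #|M| for every sigma: "if" by ln a <= a - 1, "only if" by
   comparing f along the segment from rho to sigma. As sum_mu a_mu =
   Tr(sigma G) with G the gradient at rho, this says that S = #|M| I - G is
   positive semidefinite, and Tr(rho S) = 0 then forces rho G = G rho =
   #|M| rho, which gives (ii) and (iii) with lambda = #|M|; conversely (iii)
   forces lambda = #|M|. The equality case of ln a <= a - 1 makes the numbers
   Tr(rho Y_mu) the same for all maximizers, whence uniqueness when the Y_mu
   span. Existence comes from maximizing the continuous function
   prod_mu Tr(rho Y_mu). *)
Require Import Defs.
From mathcomp Require Import all_boot all_order all_algebra.
From mathcomp Require Import sesquilinear spectral.
From mathcomp Require Import boolp classical_sets.
From mathcomp Require Import reals constructive_ereal topology normedtype derive exp.
From mathcomp Require Import ring lra.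
From mathcomp Require Import complex.
Set Implicit Arguments.
Unset Strict Implicit.
Unset Printing Implicit Defensive.
Import Order.TTheory GRing.Theory Num.Theory numFieldNormedType.Exports.
Local Open Scope ring_scope.
Local Open Scope complex_scope.
Local Open Scope sesquilinear_scope.

(** * Traces of products of positive semidefinite matrices, and density matrices *)

Lemma psdmx_adj (R : realType) d (A : 'M[R[i]]_d) : psdmx A -> A^t* = A.
Proof. by case=> + _; rewrite hermsymmxE => /eqP <-. Qed.

Lemma adjmxZ_real (R : realType) m n (t : R) (A : 'M[R[i]]_(m, n)) :
  (t%:C *: A)^t* = t%:C *: A^t*.
Proof.
by apply/matrixP => i j; rewrite !mxE rmorphM; congr (_ * _); exact: conjc_real.
Qed.

Lemma mxtrace_adj (R : realType) d (A : 'M[R[i]]_d) :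
  \tr (A^t*) = Num.conj (\tr A).
Proof. by rewrite rmorph_sum; apply: eq_bigr => i _; rewrite !mxE. Qed.

Lemma mxtrace_herm_real (R : realType) d (A B : 'M[R[i]]_d) :
  A \is hermsymmx -> B \is hermsymmx ->
  (complex.Re (\tr (A *m B)))%:C = \tr (A *m B).
Proof.
rewrite !hermsymmxE => /eqP hA /eqP hB; apply: RRe_real.
by apply/CrealP; rewrite -mxtrace_adj adjmxM -hA -hB mxtrace_mulC.
Qed.

Lemma gram_psdmx (R : realType) n d (X : 'M[R[i]]_(n, d)) : psdmx (X^t* *m X).
Proof.
split=> [|v]; first by rewrite hermsymmxE adjmxM trmxCK.
rewrite mulmxA -adjmxM -mulmxA !mxE sumr_ge0 // => i _.
by rewrite !mxE mulrC mul_conjC_ge0.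
Qed.

Lemma mxtrace_gram (R : realType) n d (X : 'M[R[i]]_(n, d)) :
  \tr (X^t* *m X) = \sum_j \sum_i `|X i j| ^+ 2.
Proof.
apply: eq_bigr => j _; rewrite mxE; apply: eq_bigr => i _.
by rewrite !mxE normCK mulrC.
Qed.

Lemma mxtrace_gram_ge0 (R : realType) n d (X : 'M[R[i]]_(n, d)) :
  0 <= \tr (X^t* *m X).
Proof.
by rewrite mxtrace_gram !sumr_ge0// => j _; rewrite sumr_ge0// => i _; exact: exprn_ge0.
Qed.

Lemma mxtrace_gram_eq0 (R : realType) n d (X : 'M[R[i]]_(n, d)) :
  \tr (X^t* *m X) = 0 -> X = 0.
Proof.
move=> X0; apply/matrixP => i j; rewrite mxE.
have ge0 k : 0 <= \sum_i `|X i k| ^+ 2 by rewrite sumr_ge0// => *; rewrite exprn_ge0.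
move/eqP: X0; rewrite mxtrace_gram psumr_eq0// => /allP/(_ j).
rewrite mem_index_enum psumr_eq0 => [/(_ isT)/allP/(_ i)|k _]; last exact: exprn_ge0.
by rewrite mem_index_enum expf_eq0 normr_eq0 => /(_ isT)/= /eqP.
Qed.

(** Take the spectral unitary with its rows scaled by the square roots of the eigenvalues;
    positivity then becomes a matter of Gram matrices. *)
Lemma psdmx_factor (R : realType) d (A : 'M[R[i]]_d) : psdmx A ->
  exists B : 'M[R[i]]_d, A = B^t* *m B.
Proof.
move=> /psdmx_spectral[U _ [D -> D0]].
exists (diag_mx (\row_j sqrtC (D 0 j)) *m U).
rewrite adjmxM -!mulmxA; congr (_ *m _); rewrite !mulmxA; congr (_ *m _).
rewrite tr_diag_mx map_diag_mx mulmx_diag; congr diag_mx; apply/rowP => j.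
have s0 : 0 <= sqrtC (D 0 j) by rewrite sqrtC_ge0.
by rewrite !mxE [X in X * _](geC0_conj s0) -expr2 sqrtCK.
Qed.

(** For A = X^t* X and B = Z^t* Z, cyclicity turns the trace into the squared Frobenius norm of Z
    X^t*. *)
Lemma mxtrace_psd_ge0 (R : realType) d (A B : 'M[R[i]]_d) :
  psdmx A -> psdmx B -> 0 <= \tr (A *m B).
Proof.
move=> /psdmx_factor[X ->] /psdmx_factor[Z ->].
rewrite -mulmxA mxtrace_mulC -!mulmxA mulmxA.
by rewrite -{1}[X]trmxCK -adjmxM mxtrace_gram_ge0.
Qed.

(** The norm of Z X^t* vanishes, and its adjoint X Z^t* is the middle factor of A B. *)
Lemma mxtrace_psd_eq0 (R : realType) d (A B : 'M[R[i]]_d) :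
  psdmx A -> psdmx B -> \tr (A *m B) = 0 -> A *m B = 0.
Proof.
move=> /psdmx_factor[X ->] /psdmx_factor[Z ->].
rewrite -mulmxA mxtrace_mulC -!mulmxA mulmxA.
rewrite -{1}[X]trmxCK -adjmxM => /mxtrace_gram_eq0 ZX.
by rewrite (mulmxA X) -{2}[X]trmxCK -adjmxM ZX trmx0 map_mx0 mul0mx mulmx0.
Qed.

Lemma psdmxD (R : realType) d (A B : 'M[R[i]]_d) :
  psdmx A -> psdmx B -> psdmx (A + B).
Proof.
move=> [+ pA] [+ pB]; rewrite !hermsymmxE => /eqP hA /eqP hB; split.
  by rewrite hermsymmxE linearD raddfD/= -hA -hB.
by move=> v; rewrite mulmxDr mulmxDl mxE addr_ge0.
Qed.

Lemma psdmxZ (R : realType) d (c : R[i]) (A : 'M[R[i]]_d) :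
  0 <= c -> psdmx A -> psdmx (c *: A).
Proof.
move=> c0 [+ pA]; rewrite !hermsymmxE => /eqP hA; split.
  by rewrite hermsymmxE linearZ/= map_mxZ /= [X in _ == X *: _](geC0_conj c0) -hA.
by move=> v; rewrite -scalemxAr -scalemxAl mxE mulr_ge0.
Qed.

Lemma density_conv (R : realType) d (t : R) (A B : 'M[R[i]]_d) :
  0 <= t -> t <= 1 -> density A -> density B ->
  density ((1 - t)%:C *: A + t%:C *: B).
Proof.
move=> t0 t1 [pA trA] [pB trB]; split.
  by apply: psdmxD; apply: psdmxZ; rewrite // ler0c// subr_ge0.
by rewrite mxtraceD !mxtraceZ trA trB !mulr1 -rmorphD/= subrK.
Qed.

(** With X a single row this produces pure states, which test positivity in
    [first_order_optimality]. *)
Lemma density_gram (R : realType) n d (X : 'M[R[i]]_(n, d)) :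
  X != 0 -> density ((\tr (X^t* *m X))^-1 *: (X^t* *m X)).
Proof.
move=> X0; have t0 : \tr (X^t* *m X) != 0.
  by apply: contraNneq X0 => /mxtrace_gram_eq0 ->.
split; last by rewrite mxtraceZ mulVf.
apply: psdmxZ; last exact: gram_psdmx.
by rewrite invr_ge0 mxtrace_gram_ge0.
Qed.

(** * Estimates for the logarithm *)

Lemma ln1D_ge (R : realType) (x : R) : -1 < x -> x / (1 + x) <= ln (1 + x).
Proof.
move=> x1; have x0 : 0 < 1 + x by lra.
rewrite -lerN2 -lnV ?posrE//.
(* The upper bound ln (1 + y) <= y is applied with 1 + y the inverse of 1 + x. *)
have e : (1 + x)^-1 = 1 + - (x / (1 + x)) by field; rewrite gt_eqF.
rewrite [X in ln X]e; apply: le_ln1Dx; rewrite ltrN2 ltr_pdivrMr// mul1r; lra.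
Qed.

(** Everything reduces to ln c <= c - 1 at c = a / b. The equality case is recorded for the sake of
    uniqueness. *)
Lemma ln_div_le (R : realType) (a b : R) : 0 < a -> 0 < b ->
  ln a - ln b <= a / b - 1 ?= iff (a == b).
Proof.
move=> a0 b0; rewrite -ln_div ?posrE//.
set c := a / b; have c0 : 0 < c by rewrite divr_gt0.
have -> : (a == b) = (c == 1).
  have b1 : b != 0 by rewrite gt_eqF.
  by apply/eqP/eqP => [ab|c1]; [rewrite /c ab divff | rewrite -[b]mul1r -c1 divfK].
have lnle (u : R) : 0 < u -> ln u <= u - 1.
  by move=> u0; rewrite -{1}(subrKC 1 u); apply: le_ln1Dx; lra.
split; first exact: lnle.
apply/eqP/eqP => [lnc|->]; last by rewrite ln1 subrr.
(* ln c = 2 ln (sqrt c) <= 2 (sqrt c - 1), so equality forces (sqrt c - 1)^2 <= 0 *)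
have : 0 < Num.sqrt c by rewrite sqrtr_gt0.
have : Num.sqrt c ^+ 2 = c by rewrite sqr_sqrtr// ltW.
move: (Num.sqrt c) => s cE s0; move: lnc (lnle s s0).
rewrite -cE lnXn//; move: (ln s) => l; rewrite -mulr_natr => e1 e2.
have {e1 e2} : (s - 1) ^+ 2 <= 0 by lra.
by rewrite exprn_even_le0//= subr_eq0 => /eqP ->; rewrite expr1n.
Qed.

(** Here (u - 2 u^2) (1 + u) = u - u^2 (1 + 2 u) <= u, so the left side is at most u / (1 + u). This
    is the quadratic remainder both along segments and for the gradient. *)
Lemma ln1D_ge_sqr (R : realType) (u : R) : - 2^-1 <= u ->
  u - 2 * u ^+ 2 <= ln (1 + u).
Proof.
move=> u2; apply: (le_trans _ (ln1D_ge _)); last lra.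
rewrite ler_pdivlMr; last lra.
have := sqr_ge0 u; nra.
Qed.

(** * Outcome probabilities and first-order optimality *)

(** The Born-rule probability, as an element of [R] so that real analysis applies; [outcomeE]
    recovers the complex trace. *)
Definition outcome (R : realType) d (M : Type) (Y : M -> 'M[R[i]]_d)
  (A : 'M[R[i]]_d) (mu : M) : R := complex.Re (\tr (A *m Y mu)).

Lemma outcomeD (R : realType) d (M : Type) (Y : M -> 'M[R[i]]_d) A B mu :
  outcome Y (A + B) mu = outcome Y A mu + outcome Y B mu.
Proof. by rewrite /outcome mulmxDl mxtraceD raddfD. Qed.

Lemma outcomeZ (R : realType) d (M : Type) (Y : M -> 'M[R[i]]_d) (t : R) A mu :
  outcome Y (t%:C *: A) mu = t * outcome Y A mu.
Proof.
rewrite /outcome -scalemxAl mxtraceZ.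
by case: (\tr _) => a b /=; rewrite mul0r subr0.
Qed.

(** The maximally mixed state, a reference point where every outcome has the positive probability 1
    / d. *)
Lemma scalar_density (R : realType) d : (0 < d)%N ->
  density ((d%:R^-1 : R)%:C *: (1%:M : 'M[R[i]]_d)).
Proof.
move=> d0; split.
  apply: psdmxZ; first by rewrite ler0c invr_ge0.
  have := gram_psdmx (1%:M : 'M[R[i]]_d).
  by rewrite trmx1 map_mx1 mulmx1.
by rewrite mxtraceZ mxtrace1 fmorphV rmorph_nat mulVf// pnatr_eq0 -lt0n.
Qed.

Section Outcome.
Variables (R : realType) (d : nat) (M : finType) (Y : M -> 'M[R[i]]_d).
Hypothesis hY : forall mu : M, density (Y mu).

Lemma outcomeE A mu : A \is hermsymmx -> (outcome Y A mu)%:C = \tr (A *m Y mu).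
Proof. by move=> hA; exact: mxtrace_herm_real hA (hY mu).1.1. Qed.

Lemma outcome_ge0 A mu : density A -> 0 <= outcome Y A mu.
Proof.
move=> [pA _]; rewrite -ler0c outcomeE; last by case: pA.
by apply: mxtrace_psd_ge0 (proj1 (hY mu)).
Qed.

Lemma outcome_gt0P A mu :
  A \is hermsymmx -> (0 < \tr (A *m Y mu)) = (0 < outcome Y A mu).
Proof. by move=> hA; rewrite -outcomeE// (ltcR 0). Qed.

Lemma loglik_fin A : (forall mu, 0 < outcome Y A mu) ->
  loglik Y A = (\sum_mu ln (outcome Y A mu))%:E.
Proof.
by move=> A0; rewrite -sumEFin; apply: eq_bigr => mu _; exact: (lne_EFin (A0 mu)).
Qed.

Lemma loglikNy_or_gt0 A :
  loglik Y A = -oo%E \/ forall mu, 0 < outcome Y A mu.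
Proof.
case: (boolP [forall mu, 0 < outcome Y A mu]) => [/forallP|]; first by right.
rewrite negb_forall => /existsP[mu]; rewrite -leNgt => mu0; left.
(* In [\bar R] the value -oo absorbs every other summand, so one infinite term decides the sum. *)
by rewrite /loglik (bigD1 mu)// le0_lneNy ?lee_fin// addNye.
Qed.

Lemma loglik_grad_herm A : A \is hermsymmx -> loglik_grad Y A \is hermsymmx.
Proof.
move=> hA; rewrite hermsymmxE /loglik_grad raddf_sum/= raddf_sum/=; apply/eqP.
apply: eq_bigr => mu _.
by rewrite -outcomeE// -fmorphV adjmxZ_real (psdmx_adj (hY mu).1).
Qed.

Lemma mxtrace_loglik_grad A B : A \is hermsymmx -> B \is hermsymmx ->
  \tr (B *m loglik_grad Y A) = (\sum_mu outcome Y B mu / outcome Y A mu)%:C.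
Proof.
move=> hA hB; rewrite /loglik_grad mulmx_sumr !raddf_sum/=.
apply: eq_bigr => mu _.
by rewrite -scalemxAr mxtraceZ -!outcomeE// mulrC rmorphM fmorphV.
Qed.

Lemma outcome_scalar mu :
  outcome Y ((d%:R^-1 : R)%:C *: (1%:M : 'M[R[i]]_d)) mu = d%:R^-1.
Proof. by rewrite outcomeZ /outcome mul1mx (hY mu).2 mulr1. Qed.

(** A maximizer does at least as well as the maximally mixed state, whose log-likelihood is
    finite. *)
Lemma maximizer_gt0 rho : (0 < d)%N -> is_maximizer (loglik Y) rho ->
  forall mu, 0 < outcome Y rho mu.
Proof.
move=> d0 [_ /(_ _ (scalar_density R d0))].
case: (loglikNy_or_gt0 rho) => [->|//]; rewrite leeNy_eq loglik_fin//.
by move=> mu; rewrite outcome_scalar invr_gt0 ltr0n.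
Qed.

(* Along (1 - t) rho + t sigma the log-likelihood increases by at least
   t S - 2 t^2 Q, where S and Q are the sums over mu of b and b^2,
   b + 1 = outcome sigma / outcome rho; so S > 0 would contradict maximality. *)
Lemma maximizer_first_order rho sigma : (0 < d)%N ->
  is_maximizer (loglik Y) rho -> density sigma ->
  \sum_mu outcome Y sigma mu / outcome Y rho mu <= #|M|%:R.
Proof.
move=> d0 mrho dsigma; have x0 := maximizer_gt0 d0 mrho.
case: mrho => drho mrho.
pose b mu := outcome Y sigma mu / outcome Y rho mu - 1.
have b1 mu : -1 <= b mu by rewrite lerBrDl subrr divr_ge0 ?outcome_ge0.
rewrite -subr_le0 -[#|M|%:R]sumr_const -sumrB -/(b _).
set S := \sum_mu _; pose Q := \sum_mu b mu ^+ 2.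
have Q0 : 0 <= Q by apply: sumr_ge0 => mu _; rewrite sqr_ge0.
(* As b >= -1, the bound t <= 1/2 gives t b >= -1/2, the range of [ln1D_ge_sqr]. *)
have key t : 0 < t -> t <= 2^-1 -> S <= 2 * t * Q.
  move=> t0 t2; have tb mu : - 2^-1 <= t * b mu by have := b1 mu; nra.
  have xE mu : outcome Y ((1 - t)%:C *: rho + t%:C *: sigma) mu
      = outcome Y rho mu * (1 + t * b mu).
    rewrite outcomeD !outcomeZ /b; have := lt0r_neq0 (x0 mu).
    by move: (outcome Y rho mu) (outcome Y sigma mu) => x y xn0; field.
  have := mrho _ (density_conv (ltW t0) _ drho dsigma).
  have -> : (t <= 1) by lra.
  move=> /(_ isT); rewrite !loglik_fin//; last first.
    by move=> mu; rewrite xE mulr_gt0//; have := tb mu; lra.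
  rewrite lee_fin -subr_le0 -sumrB => le0.
  rewrite -(ler_pM2l t0) -subr_le0; apply: le_trans le0.
  rewrite mulr_sumr mulrA mulr_sumr -sumrB; apply: ler_sum => mu _.
  rewrite xE lnM ?posrE//; last by have := tb mu; lra.
  rewrite addrAC subrr add0r; apply: le_trans (ln1D_ge_sqr (tb mu)).
  by rewrite le_eqVlt; apply/orP; left; apply/eqP; rewrite -/(b mu); ring.
rewrite leNgt; apply/negP => S0.
have h0 : 0 < 4 * Q + 2 * S by lra.
(* This t is at most 1/2, and [key] would give 2 Q S + 2 S^2 <= 0; the summand 2 S keeps the
   denominator positive when Q = 0. *)
have := key (S / (4 * Q + 2 * S)).
rewrite divr_gt0// ler_pdivrMr// => /(_ isT).
have -> : S <= 2^-1 * (4 * Q + 2 * S) by lra.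
move=> /(_ isT); rewrite mulrA mulrAC ler_pdivlMr//; nra.
Qed.

Lemma first_order_optimality rho : (0 < #|M|)%N -> density rho ->
  (forall mu, 0 < outcome Y rho mu) ->
  (forall sigma, density sigma ->
     \sum_mu outcome Y sigma mu / outcome Y rho mu <= #|M|%:R) ->
  optimality_conditions Y rho.
Proof.
move=> M0 drho x0 fo; have hrho : rho \is hermsymmx by case: drho => [[]].
have rhoA : rho^t* = rho by apply: psdmx_adj; case: drho.
pose G := loglik_grad Y rho; have hG : G \is hermsymmx by exact: loglik_grad_herm.
have GA : G^t* = G by move: hG; rewrite hermsymmxE => /eqP <-.
pose l : R := #|M|%:R; pose S := l%:C *: 1%:M - G.
have trS A : density A ->
    \tr (A *m S) = (l - \sum_mu outcome Y A mu / outcome Y rho mu)%:C.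
  move=> [[hA _] trA]; rewrite /S mulmxBr raddfB/= (mxtrace_loglik_grad hrho hA).
  by rewrite -scalemxAr mulmx1 mxtraceZ trA mulr1 -rmorphB.
have SA : S^t* = S.
  by rewrite /S linearB raddfB/= adjmxZ_real trmx1 map_mx1 GA.
have pS : psdmx S.
  split=> [|v]; first by rewrite hermsymmxE SA.
  have [->|v0] := eqVneq v 0; first by rewrite mulmx0 mxE.
  have v'0 : v^t* != 0 by apply: contraNneq v0 => v0; rewrite -[v]trmxCK v0 trmx0 map_mx0.
  have c0 : 0 < \tr (v^t*^t* *m v^t*).
    rewrite lt_neqAle eq_sym mxtrace_gram_ge0 andbT.
    by apply: contraNneq v'0 => /mxtrace_gram_eq0 ->.
  (* The test state is proportional to v v^t*; its trace against S is v^t* S v up to a positive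
     factor. *)
  have ds := density_gram v'0.
  rewrite trmxCK -invr_gt0 in c0; rewrite trmxCK in ds.
  rewrite -trace_mx11 -mulmxA mxtrace_mulC -mulmxA mxtrace_mulC.
  rewrite -(pmulr_rge0 _ c0) -mxtraceZ scalemxAl (trS _ ds) ler0c subr_ge0.
  exact: fo ds.
(* Complementary slackness: at sigma = rho all ratios are 1, so the trace of rho S is 0. *)
have rS : rho *m S = 0.
  apply: (mxtrace_psd_eq0 drho.1 pS).
  rewrite trS// (eq_bigr (fun=> 1)) ?sumr_const ?subrr// => mu _.
  by rewrite divff// gt_eqF.
have rG : rho *m G = l%:C *: rho.
  by apply/esym/eqP; rewrite -subr_eq0 -{1}[rho]mulmx1 scalemxAr -mulmxBr rS.
have Gr : G *m rho = l%:C *: rho.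
  by rewrite -{1}rhoA -{1}GA -adjmxM rG adjmxZ_real rhoA.
split; first by move=> mu; rewrite outcome_gt0P.
  by rewrite rG Gr subrr.
exists l; split; [by rewrite ltr0n | | exact: pS].
(* The projector factors as X rho, so rho G = l rho carries over to it. *)
have /submxP[X ->] : (range_proj rho <= rho)%MS by rewrite /range_proj proj_orthoE rhoA.
by rewrite -mulmxA rG scalemxAr.
Qed.

Lemma optimality_first_order rho sigma : density rho ->
  optimality_conditions Y rho -> density sigma ->
  \sum_mu outcome Y sigma mu / outcome Y rho mu <= #|M|%:R.
Proof.
move=> [[hrho prho] trrho] [x0 _ [l [l0 lP lG]]] [psigma trsigma].
have rhoA := psdmx_adj (conj hrho prho).
have hsigma : sigma \is hermsymmx by case: psigma.
have rG : rho *m loglik_grad Y rho = l%:C *: rho.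
  have /submxP[X XE] : (rho <= range_proj rho)%MS by rewrite /range_proj proj_orthoE rhoA.
  by rewrite {1}XE -mulmxA -lP -scalemxAr -XE.
(* Take traces in rho G = l rho: the left side is a sum of ones over M, the right side is l. *)
have lE : l = #|M|%:R.
  apply: (@complexI R); have := congr1 mxtrace rG.
  rewrite (mxtrace_loglik_grad hrho hrho) mxtraceZ trrho mulr1 => <-.
  rewrite (eq_bigr (fun=> 1)) ?sumr_const// => mu _.
  by rewrite divff// gt_eqF// -outcome_gt0P.
have := mxtrace_psd_ge0 psigma lG.
rewrite mulmxBr raddfB/= (mxtrace_loglik_grad hrho hsigma) -scalemxAr mulmx1 mxtraceZ.
by rewrite trsigma mulr1 -rmorphB ler0c subr_ge0 lE.
Qed.

Lemma first_order_maximizer rho : density rho ->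
  (forall mu, 0 < outcome Y rho mu) ->
  (forall sigma, density sigma ->
     \sum_mu outcome Y sigma mu / outcome Y rho mu <= #|M|%:R) ->
  is_maximizer (loglik Y) rho.
Proof.
move=> drho x0 fo; split=> // sigma dsigma.
have [->|s0] := loglikNy_or_gt0 sigma; first exact: leNye.
rewrite !loglik_fin// lee_fin -subr_le0 -sumrB.
apply: (@le_trans _ _ (\sum_mu (outcome Y sigma mu / outcome Y rho mu - 1))).
  by apply: ler_sum => mu _; rewrite (ln_div_le (s0 mu) (x0 mu)).
by rewrite sumrB sumr_const subr_le0 fo.
Qed.

(** Equal values of f make the differences of logarithms sum to 0, while the first-order inequality
    at [sigma] makes their upper bounds sum to at most 0; hence [ln_div_le] is an equality for each
    outcome. *)
Lemma maximizer_outcome_inj rho sigma mu : (0 < d)%N ->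
  is_maximizer (loglik Y) rho -> is_maximizer (loglik Y) sigma ->
  outcome Y rho mu = outcome Y sigma mu.
Proof.
move=> d0 mr ms; have r0 := maximizer_gt0 d0 mr; have s0 := maximizer_gt0 d0 ms.
have := maximizer_first_order d0 ms mr.1.
have : (loglik Y rho = loglik Y sigma).
  by apply/eqP; rewrite eq_le mr.2 ?ms.2//; [exact: mr.1|exact: ms.1].
rewrite !loglik_fin// => -[/eqP]; rewrite -subr_eq0 -sumrB => /eqP e0.
rewrite -subr_le0 -[#|M|%:R]sumr_const -sumrB => le0.
have := @leif_sum R M xpredT _ _ _ (fun mu _ => ln_div_le (r0 mu) (s0 mu)).
by rewrite /= e0 => -[ge0]; rewrite eq_le ge0 le0 => /esym/forallP/(_ mu)/eqP.
Qed.

(** The difference H of two maximizers is orthogonal to every Y_mu and lies in their span, so the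
    trace of H H is 0. *)
Lemma maximizer_unique rho sigma : (0 < d)%N ->
  (forall H : 'M[R[i]]_d, H \is hermsymmx ->
     exists c : M -> R, H = \sum_mu (c mu)%:C *: Y mu) ->
  is_maximizer (loglik Y) rho -> is_maximizer (loglik Y) sigma -> rho = sigma.
Proof.
move=> d0 span mr ms; pose H := rho - sigma.
have [[hr _] [hs _]] := (mr.1.1, ms.1.1).
have HA : H^t* = H by rewrite /H linearB raddfB/= (psdmx_adj mr.1.1) (psdmx_adj ms.1.1).
have [|c HE] := span H; first by rewrite hermsymmxE HA.
apply/eqP; rewrite -subr_eq0 -/H; apply/eqP/mxtrace_gram_eq0.
rewrite HA {2}HE mulmx_sumr raddf_sum/= big1// => mu _.
rewrite -scalemxAr mxtraceZ mulmxBl raddfB/= -!outcomeE//.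
by rewrite (maximizer_outcome_inj mu d0 mr ms) subrr mulr0.
Qed.

End Outcome.

(** * Continuity of complex matrix expressions, and compactness of the density matrices *)

Section ComplexContinuity.
Variables (R : realType) (T : topologicalType).
Implicit Types f g : T -> R[i].

(** Stated through real and imaginary parts, so that only the topology of [R] is involved on the
    target side. *)
Definition ccontinuous f : Prop :=
  continuous (fun x => complex.Re (f x)) /\ continuous (fun x => complex.Im (f x)).

Lemma ccontinuousD f g :
  ccontinuous f -> ccontinuous g -> ccontinuous (fun x => f x + g x).
Proof.
move=> [f1 f2] [g1 g2]; split.
  under [X in continuous X]funext do rewrite raddfD.
  by move=> x; apply: continuousD; [exact: f1|exact: g1].
under [X in continuous X]funext do rewrite raddfD.
by move=> x; apply: continuousD; [exact: f2|exact: g2].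
Qed.

Lemma ccontinuousM f g :
  ccontinuous f -> ccontinuous g -> ccontinuous (fun x => f x * g x).
Proof.
move=> [f1 f2] [g1 g2]; split.
  rewrite (_ : (fun x => _) = fun x => complex.Re (f x) * complex.Re (g x)
      - complex.Im (f x) * complex.Im (g x)).
    by move=> x; exact: (continuousB (continuousM (f1 x) (g1 x))
                                     (continuousM (f2 x) (g2 x))).
  by apply/funext => x; case: (f x) (g x) => [? ?] [? ?].
rewrite (_ : (fun x => _) = fun x => complex.Re (f x) * complex.Im (g x)
    + complex.Im (f x) * complex.Re (g x)).
  by move=> x; exact: (continuousD (continuousM (f1 x) (g2 x))
                                   (continuousM (f2 x) (g1 x))).
by apply/funext => x; case: (f x) (g x) => [? ?] [? ?].
Qed.

Lemma ccontinuous_sum (I : Type) (r : seq I) (F : I -> T -> R[i]) :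
  (forall i, ccontinuous (F i)) -> ccontinuous (fun x => \sum_(i <- r) F i x).
Proof.
move=> cF; elim: r => [|i r IH].
  under [X in ccontinuous X]funext do rewrite big_nil.
  by split=> x; exact: cst_continuous.
under [X in ccontinuous X]funext do rewrite big_cons.
exact: ccontinuousD.
Qed.

Definition mxcontinuous m n (A : T -> 'M[R[i]]_(m, n)) : Prop :=
  forall i j, ccontinuous (fun x => A x i j).

Lemma mxcontinuous_cst m n (A : 'M[R[i]]_(m, n)) : mxcontinuous (fun=> A).
Proof. by move=> i j; split=> x; exact: cst_continuous. Qed.

Lemma mxcontinuous_mul m n p (A : T -> 'M[R[i]]_(m, n)) (B : T -> 'M[R[i]]_(n, p)) :
  mxcontinuous A -> mxcontinuous B -> mxcontinuous (fun x => A x *m B x).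
Proof.
move=> cA cB i j; under [X in ccontinuous X]funext do rewrite mxE.
by apply: ccontinuous_sum => k; exact: ccontinuousM.
Qed.

Lemma mxcontinuous_adj m n (A : T -> 'M[R[i]]_(m, n)) :
  mxcontinuous A -> mxcontinuous (fun x => (A x)^t*).
Proof.
move=> cA i j; have [re im] := cA j i; split.
  rewrite (_ : (fun x => _) = fun x => complex.Re (A x j i))//.
  by apply/funext => x; rewrite !mxE; case: (A x j i).
rewrite (_ : (fun x => _) = fun x => - complex.Im (A x j i)).
  by move=> x; apply: continuousN; exact: im.
by apply/funext => x; rewrite !mxE; case: (A x j i).
Qed.

Lemma mxcontinuous_trace n (A : T -> 'M[R[i]]_n) :
  mxcontinuous A -> ccontinuous (fun x => \tr (A x)).
Proof. by move=> cA; apply: ccontinuous_sum => i. Qed.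

End ComplexContinuity.

(* The map B |-> B^t* *m B sends the compact sphere \tr (B^t* *m B) = 1 onto
   the density matrices; the entries of B are read off a real row vector. *)
Lemma density_max (R : realType) d (F : 'M[R[i]]_d -> R) : (0 < d)%N ->
  (forall (T : topologicalType) (A : T -> 'M[R[i]]_d),
     mxcontinuous A -> continuous (fun x => F (A x))) ->
  exists2 rho, density rho & forall sigma, density sigma -> F sigma <= F rho.
Proof.
move=> d0 cF.
pose B (w : 'rV[R]_(d * d + d * d)) : 'M[R[i]]_d := \matrix_(i, j)
  (w 0 (lshift _ (mxvec_index i j)) +i* w 0 (rshift _ (mxvec_index i j))).
have cB : mxcontinuous B.
  move=> i j; split; under [X in continuous X]funext do rewrite mxE /=;
  exact: coord_continuous.
have cBB : mxcontinuous (fun w => (B w)^t* *m B w).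
  by apply: mxcontinuous_mul => //; exact: mxcontinuous_adj.
have [ctr _] := mxcontinuous_trace cBB.
pose K := [set w | complex.Re (\tr ((B w)^t* *m B w)) = 1]%classic.
have trK w : K w -> \tr ((B w)^t* *m B w) = 1.
  rewrite /K/= => Kw; rewrite -[RHS](congr1 (real_complex R) Kw); apply/esym/RRe_real/ger0_real.
  exact: mxtrace_gram_ge0.
have dK w : K w -> density ((B w)^t* *m B w).
  by move=> /trK trw; split=> //; exact: gram_psdmx.
have surj rho : density rho -> exists2 w, K w & rho = (B w)^t* *m B w.
  move=> [/psdmx_factor[X ->] trX].
  exists (row_mx (mxvec (map_mx (@complex.Re R) X)) (mxvec (map_mx (@complex.Im R) X))).
    rewrite /K/=; set X' := B _; suff -> : X' = X by rewrite trX.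
    apply/matrixP => i j; rewrite mxE row_mxEl row_mxEr !mxvecE !mxE.
    by case: (X i j).
  set X' := B _; suff -> : X' = X by [].
  apply/matrixP => i j; rewrite mxE row_mxEl row_mxEr !mxvecE !mxE.
  by case: (X i j).
have compactK : compact K.
  (* The trace is the sum of the squared moduli of the entries, so on [K] every real coordinate has
     absolute value at most 1. *)
  apply: bounded_closed_compact.
    exists 1; split; first exact: num_real.
    move=> r r1 w /trK trw /=; apply: le_trans (ltW r1).
    rewrite (mx_normrE w : `|w| = _); apply/bigmax_leP; split=> // -[i k] _ /=.
    rewrite ord1 {i}.
    have le1 i j : `|B w i j| ^+ 2 <= 1.
      rewrite -trw mxtrace_gram (bigD1 j)//= (bigD1 i)//= -addrA lerDl addr_ge0//.
        by apply: sumr_ge0 => l _; rewrite exprn_ge0.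
      by apply: sumr_ge0 => l _; apply: sumr_ge0 => l' _; rewrite exprn_ge0.
    have {}le1 i j : complex.Re (B w i j) ^+ 2 + complex.Im (B w i j) ^+ 2 <= 1.
      by rewrite -lecR add_Re2_Im2.
    rewrite -(@ler_pXn2r _ 2)// ?nnegrE// expr1n real_normK ?num_real//.
    case: (split_ordP k) => l ->; case/mxvec_indexP: l => i j;
      have := le1 i j; rewrite mxE/=; apply: le_trans; by rewrite ?lerDl ?lerDr sqr_ge0.
  apply: (@preimage_closed _ _ (fun w => complex.Re (\tr ((B w)^t* *m B w)))
    [set x | x = 1]%classic).
    by move=> w _; exact: ctr.
  exact: closed_eq.
(* The maximally mixed state shows [K] non-empty; the hypothesis on [F] is used along the family
   B^t* B indexed by the coordinates. *)
have [w Kw wmax] := @compact_EVT_max _ R (fun w => F ((B w)^t* *m B w)) K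
  (let: ex_intro2 w Kw _ := surj _ (scalar_density R d0) in ex_intro _ w Kw)
  compactK (continuous_subspaceT (cF _ _ cBB)).
exists ((B w)^t* *m B w); first by apply: dK; rewrite inE in Kw.
by move=> _ /surj[v Kv ->]; apply: wmax; rewrite inE.
Qed.

Lemma ln_prod (R : realType) (I : finType) (f : I -> R) :
  (forall i, 0 < f i) -> ln (\prod_i f i) = \sum_i ln (f i).
Proof.
move=> f0; apply: expR_inj; rewrite lnK ?posrE ?prodr_gt0// expR_sum.
by apply: eq_bigr => i _; rewrite lnK ?posrE.
Qed.

(** * Existence of a maximizer, and the Frobenius gradient *)

Section Extremum.
Variables (R : realType) (d : nat) (M : finType) (Y : M -> 'M[R[i]]_d).
Hypothesis hY : forall mu : M, density (Y mu).

Lemma outcome_continuous (T : topologicalType) (A : T -> 'M[R[i]]_d) mu :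
  mxcontinuous A -> continuous (fun x => outcome Y (A x) mu).
Proof.
move=> cA; have cY := mxcontinuous_cst T (Y mu).
by have [] := mxcontinuous_trace (mxcontinuous_mul cA cY).
Qed.

(** The product of the outcomes stays finite and continuous where f is -oo. Its maximum is positive,
    by comparison with the maximally mixed state, so the logarithm transfers it to f. *)
Lemma maximizer_exists : (0 < d)%N -> exists rho, is_maximizer (loglik Y) rho.
Proof.
move=> d0; have [|rho drho rmax] :=
  @density_max R d (fun A => \prod_mu outcome Y A mu) d0.
  move=> T A cA; apply: continuous_big => [|mu _].
    exact: mul_continuous.
  exact: outcome_continuous.
have rho0 mu : 0 < outcome Y rho mu.
  rewrite lt_neqAle outcome_ge0// andbT eq_sym.
  have : 0 < \prod_mu outcome Y rho mu.
    apply: lt_le_trans (rmax _ (scalar_density R d0)).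
    by apply: prodr_gt0 => nu _; rewrite outcome_scalar// invr_gt0 ltr0n.
  by apply: contraTneq => r0; rewrite (bigD1 mu)//= r0 mul0r ltxx.
exists rho; split=> // sigma dsigma.
have [->|s0] := loglikNy_or_gt0 Y sigma; first exact: leNye.
rewrite (loglik_fin s0) (loglik_fin rho0) lee_fin -(ln_prod s0) -(ln_prod rho0).
by rewrite ler_ln ?rmax// posrE prodr_gt0.
Qed.

Lemma frob_norm_sqr (H : 'M[R[i]]_d) : H \is hermsymmx ->
  (frob_norm H ^+ 2)%:C = \tr (H *m H).
Proof.
move=> hH; rewrite /frob_norm sqr_sqrtr; first exact: mxtrace_herm_real.
rewrite -ler0c mxtrace_herm_real// {1}(_ : H = H^t*).
  exact: mxtrace_gram_ge0.
by move: hH; rewrite hermsymmxE => /eqP.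
Qed.

(* Cauchy-Schwarz with frob_norm (Y mu) <= 1, read off
   0 <= frob_norm (H - h *: Y mu) ^+ 2 at h = outcome Y H mu. *)
Lemma outcome_le_frob_norm (H : 'M[R[i]]_d) mu : H \is hermsymmx ->
  `|outcome Y H mu| <= frob_norm H.
Proof.
move=> hH; set h := outcome _ _ _.
have hYmu := (hY mu).1.1.
pose X := H + (- h)%:C *: Y mu.
have hX : X \is hermsymmx.
  move: hH; rewrite !hermsymmxE => /eqP hH.
  by rewrite /X raddfD/= raddfD/= adjmxZ_real -hH (psdmx_adj (hY mu).1).
pose y := outcome Y (Y mu) mu.
have HY : \tr (H *m Y mu) = h%:C by rewrite /h outcomeE.
have YY : \tr (Y mu *m Y mu) = y%:C by rewrite /y outcomeE.
have XX : frob_norm X ^+ 2 = frob_norm H ^+ 2 - 2 * h ^+ 2 + h ^+ 2 * y.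
  apply: (@complexI R); rewrite (frob_norm_sqr hX) /X mulmxDl !mulmxDr.
  rewrite -!scalemxAl -!scalemxAr !mxtraceD !mxtraceZ.
  rewrite [\tr (Y mu *m H)]mxtrace_mulC HY YY -(frob_norm_sqr hH).
  by rewrite -!rmorphM -!rmorphD; congr (_%:C); ring.
have /andP[_] := trmx_density_itv (hY mu) (hY mu).
rewrite YY lecR => y1; have := sqr_ge0 (frob_norm X); rewrite XX => le0.
rewrite -(@ler_pXn2r _ 2) ?nnegrE// ?sqrtr_ge0// real_normK ?num_real//.
have := sqr_ge0 h; nra.
Qed.

(** With u the relative change of an outcome, each remainder ln (1 + u) - u lies between -2 u^2 and
    0, and u is bounded by the norm of H divided by that outcome. *)
Lemma loglik_gradient rho : density rho -> (forall mu, 0 < outcome Y rho mu) ->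
  is_frob_gradient (loglik Y) rho (loglik_grad Y rho).
Proof.
move=> drho x0; have hrho := drho.1.1.
split; first exact: loglik_grad_herm.
move=> eps eps0; pose x := outcome Y rho.
pose L := \sum_mu (x mu)^-1; pose K := \sum_mu 2 * ((x mu)^-1) ^+ 2.
have L0 : 0 <= L by apply: sumr_ge0 => mu _; rewrite invr_ge0 ltW.
have K0 : 0 <= K by apply: sumr_ge0 => mu _; rewrite mulr_ge0// sqr_ge0.
(* The first radius forces |u| <= 1/2, since each inverse outcome is at most L; the second makes N K
   at most eps. Adding 1 keeps both denominators positive. *)
exists (Num.min (2 * (L + 1))^-1 (eps / (K + 1))).
  by rewrite lt_min invr_gt0 divr_gt0 ?mulr_gt0//; lra.
move=> H hH; set N := frob_norm H; rewrite lt_min => /andP[NL NK].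
have N0 : 0 <= N by exact: sqrtr_ge0.
pose u mu := outcome Y H mu / x mu.
have uN mu : `|u mu| <= N * (x mu)^-1.
  rewrite /u normrM normfV (gtr0_norm (x0 mu)) ler_wpM2r ?outcome_le_frob_norm//.
  by rewrite invr_ge0 ltW.
have u2 mu : `|u mu| <= 2^-1.
  apply: le_trans (uN mu) _; apply: (@le_trans _ _ (N * L)).
    rewrite ler_wpM2l// /L (bigD1 mu)//= lerDl.
    by apply: sumr_ge0 => nu _; rewrite invr_ge0 ltW.
  move: NL; rewrite -[(_)^-1]div1r ltr_pdivlMr; last lra.
  nra.
have xH mu : outcome Y (rho + H) mu = x mu * (1 + u mu).
  by rewrite outcomeD /u -/(x mu) mulrDr mulr1 mulrCA divff ?mulr1// gt_eqF.
have u1 mu : 0 < 1 + u mu by move: (u2 mu); rewrite ler_norml => /andP[]; lra.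
rewrite !loglik_fin//; last by move=> mu; rewrite xH mulr_gt0.
rewrite /frob_prod mxtrace_mulC mxtrace_loglik_grad//=.
rewrite lee_fin -!sumrB; apply: le_trans (ler_norm_sum _ _ _) _.
apply: (@le_trans _ _ (N ^+ 2 * K)).
  rewrite mulr_sumr; apply: ler_sum => mu _.
  have -> : ln (outcome Y (rho + H) mu) - ln (outcome Y rho mu)
      - outcome Y H mu / outcome Y rho mu = ln (1 + u mu) - u mu.
    rewrite xH lnM ?posrE// -/(x mu) -/(u mu).
    by move: (ln (x mu)) (ln (1 + u mu)) => a b; ring.
  have lu : ln (1 + u mu) <= u mu by apply: le_ln1Dx; have := u1 mu; lra.
  rewrite ler0_norm ?subr_le0// opprB lerBlDr.
  have u2' : u mu ^+ 2 <= N ^+ 2 * (x mu)^-1 ^+ 2.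
    rewrite -exprMn -[u mu ^+ 2]real_normK ?num_real// lerXn2r ?nnegrE//.
    by rewrite mulr_ge0// invr_ge0 ltW.
  have : - 2^-1 <= u mu by move: (u2 mu); rewrite ler_norml => /andP[].
  move=> /ln1D_ge_sqr; move: u2' lu.
  by move: (u mu) (ln _) ((x mu)^-1 ^+ 2) => a b c; lra.
rewrite expr2 -mulrA mulrC ler_wpM2r//.
move: NK; rewrite ltr_pdivlMr; last lra.
nra.
Qed.

End Extremum.

Theorem lemma2 (R : realType) (d : nat) (hd : (1 <= d)%N)
    (M : finType) (hM : (0 < #|M|)%N)
    (Y : M -> 'M[R[i]]_d) (hY : forall mu : M, density (Y mu)) :
  (forall rho : 'M[R[i]]_d, density rho ->
     (forall mu : M, 0 < \tr (rho *m Y mu)) ->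
     is_frob_gradient (loglik Y) rho (loglik_grad Y rho)) /\
  (forall rho : 'M[R[i]]_d,
     is_maximizer (loglik Y) rho -> optimality_conditions Y rho) /\
  ((forall H : 'M[R[i]]_d, H \is hermsymmx <->
      exists c : M -> R, H = \sum_(mu : M) (c mu)%:C *: Y mu) ->
   (exists! rho : 'M[R[i]]_d, is_maximizer (loglik Y) rho) /\
   (forall rho : 'M[R[i]]_d, density rho ->
      (is_maximizer (loglik Y) rho <-> optimality_conditions Y rho))).
Proof.
have necessary rho : is_maximizer (loglik Y) rho -> optimality_conditions Y rho.
  move=> mrho; apply: first_order_optimality (maximizer_gt0 hY hd mrho) _ => //.
    exact: mrho.1.
  by move=> sigma; exact: maximizer_first_order.
split; [|split=> // span; split].
- move=> rho drho rho0; apply: loglik_gradient => // mu.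
  by rewrite -(outcome_gt0P hY) ?rho0//; exact: drho.1.1.
- have [rho mrho] := maximizer_exists hY hd.
  exists rho; split=> // sigma; apply: (maximizer_unique hY hd) => // H.
  by move=> /span.
- move=> rho drho; split; first exact: necessary.
  move=> opt; apply: first_order_maximizer => //.
    by case: opt => rho0 _ _ mu; rewrite -(outcome_gt0P hY) ?rho0//; exact: drho.1.1.
  by move=> sigma; exact: (optimality_first_order hY drho opt).
Qed.
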